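(* Let $R$ be a Cohen–Macaulay ring and let $I$ be a height unmixed ideal of $R$ which is generically a complete intersection. Put $L = I\colon \sqrt{I}$. Then $I$ is integrally closed if and only if $$\sqrt{I} = IL \colon L^2 .$$
   Context: All rings are commutative and Noetherian. For ideals $A,B$ of $R$, $A\colon B=\{r\in R : rB\subseteq A\}$. The integral closure $\overline{I}$ of $I$ is the ideal of all $z\in R$ satisfying an equation $z^n+a_1z^{n-1}+\cdots+a_n=0$ with $a_i\in I^i$; $I$ is integrally closed if $I=\overline{I}$. The ideal $I$ is height unmixed if it is proper and all associated primes of $R/I$ have the same height, equal to the height of $I$. An ideal satisfies a property generically if $I_{\mathfrak p}\subset R_{\mathfrak p}$ satisfies it for every minimal prime $\mathfrak p$ of $I$; thus $I$ is generically a complete intersection if $I_{\mathfrak p}$ is generated by an $R_{\mathfrak p}$-regular sequence for every minimal prime $\mathfrak p$ of $I$. *)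

(* Defs.v *)
From HB Require Import structures.
From mathcomp Require Import all_boot all_order all_algebra.
From mathcomp Require Import boolp classical_sets ring.

Set Implicit Arguments.
Unset Strict Implicit.
Unset Printing Implicit Defensive.

Import GRing.Theory.
Local Open Scope classical_set_scope.
Local Open Scope ring_scope.
Local Open Scope quotient_scope.

Section Ideals.
Variable R : comNzRingType.
Implicit Types (A B I J P : set R) (s : seq R).

(* Unlike [idealr_closed], the unit ideal is allowed: colon ideals such as
   [IL : L^2] need not be proper. *)
Definition is_ideal I : Prop :=
  [/\ I 0,
      forall x y, I x -> I y -> I (x + y)
    & forall a x, I x -> I (a * x)].

Definition is_proper_ideal I : Prop := is_ideal I /\ I <> setT.

Definition prime_ideal P : Prop :=
  is_proper_ideal P /\ forall x y, P (x * y) -> P x \/ P y.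

Definition maximal_ideal P : Prop :=
  is_proper_ideal P /\ forall J, is_proper_ideal J -> P `<=` J -> J = P.

Definition ideal_gen A : set R := smallest is_ideal A.

Definition ideal_mul I J : set R :=
  ideal_gen [set z | exists x y, [/\ I x, J y & z = x * y]].

Fixpoint ideal_exp I (n : nat) : set R :=
  if n is n'.+1 then ideal_mul I (ideal_exp I n') else setT.

Definition colon A B : set R := [set r | forall b, B b -> A (r * b)].

Definition radical I : set R := [set r | exists n : nat, I (r ^+ n)].

Definition noetherian : Prop :=
  forall I, is_ideal I -> exists s, I = ideal_gen [set` s].

Definition integral_closure I : set R :=
  [set z | exists (n : nat) (a : nat -> R),
     [/\ (0 < n)%N,
         forall i : nat, (1 <= i <= n)%N -> ideal_exp I i (a i)
       & z ^+ n + \sum_(1 <= i < n.+1) a i * z ^+ (n - i)%N = 0]].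

Definition integrally_closed I : Prop := I = integral_closure I.

Definition minimal_prime I P : Prop :=
  [/\ prime_ideal P, I `<=` P
    & forall Q, prime_ideal Q -> I `<=` Q -> Q `<=` P -> Q = P].

(* P is the annihilator of the class of some x in R/I. *)
Definition associated_prime I P : Prop :=
  prime_ideal P /\ exists x, P = colon I [set x].

(* c 0 < c 1 < ... < c n = P is a chain of primes of length n *)
Definition prime_chain_to P (n : nat) : Prop :=
  exists c : nat -> set R,
    [/\ c n = P,
        forall i : nat, (i <= n)%N -> prime_ideal (c i)
      & forall i : nat, (i < n)%N -> c i `<` c i.+1].

(* A chain can be shortened from below, so this says that the supremum of the
   lengths of the chains ending at P is n. *)
Definition prime_height P (n : nat) : Prop :=
  prime_chain_to P n /\ ~ prime_chain_to P n.+1.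

(* Infimum of the heights of the primes containing I. *)
Definition ideal_height I (n : nat) : Prop :=
  (exists P, [/\ prime_ideal P, I `<=` P & prime_height P n]) /\
  (forall P, prime_ideal P -> I `<=` P -> prime_chain_to P n).

Definition krull_dim (n : nat) : Prop :=
  (exists P, prime_chain_to P n) /\ ~ (exists P, prime_chain_to P n.+1).

Definition height_unmixed I : Prop :=
  is_proper_ideal I /\
  exists h : nat, ideal_height I h /\
    forall P, associated_prime I P -> prime_height P h.

(* Each s_i is a nonzerodivisor on R/(s_0, ..., s_(i-1)), and R/(s) != 0. *)
Definition regular_seq s : Prop :=
  ideal_gen [set` s] <> setT /\
  forall i : nat, (i < size s)%N ->
    forall y, ideal_gen [set` take i s] (nth 0 s i * y) ->
              ideal_gen [set` take i s] y.

(* Maximal length of a regular sequence contained in I. *)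
Definition depth I (n : nat) : Prop :=
  (exists s, [/\ regular_seq s, [set` s] `<=` I & size s = n]) /\
  (forall s, regular_seq s -> [set` s] `<=` I -> (size s <= n)%N).

Definition local_ring_at P : Prop :=
  maximal_ideal P /\ forall J, maximal_ideal J -> J = P.

Definition complete_intersection I : Prop :=
  exists s, regular_seq s /\ I = ideal_gen [set` s].

End Ideals.

Arguments noetherian R : clear implicits.
Arguments krull_dim R n : clear implicits.

Definition cohen_macaulay_local (S : comNzRingType) : Prop :=
  noetherian S /\
  exists (m : set S) (d : nat),
    [/\ local_ring_at m, depth m d & krull_dim S d].

Record spec (R : comNzRingType) : Type := Spec {
  spec_set :> set R;
  spec_prime : prime_ideal spec_set
}.

(* The localization of R at a prime p, as the quotient of the set of pairs
   (a, s) with s outside p by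
   (a, s) ~ (b, t)  iff  u (a t - b s) = 0 for some u outside p. *)
Section Localization.
Variables (R : comNzRingType) (p : spec R).

Definition denom : Type := {s : R | s \notin spec_set p}.
HB.instance Definition _ := Choice.on denom.

Lemma denP (s : denom) : ~ spec_set p (val s).
Proof. by move=> ps; have := valP s; rewrite notin_setE. Qed.

Lemma spec_not1 : ~ spec_set p 1.
Proof.
case: (spec_prime p) => -[[_ _ pM] pT] _ p1; apply: pT.
by rewrite -subTset => x _; rewrite -[x]mulr1; apply: pM.
Qed.

Lemma den1_subproof : 1 \notin spec_set p.
Proof. by rewrite notin_setE; apply: spec_not1. Qed.

Lemma den_mul_subproof (s t : denom) : val s * val t \notin spec_set p.
Proof.
rewrite notin_setE => pst; case: (spec_prime p) => _ pP.
by case: (pP _ _ pst); apply: denP.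
Qed.

Definition den1 : denom := exist _ 1 den1_subproof.
Definition den_mul (s t : denom) : denom :=
  exist _ (val s * val t) (den_mul_subproof s t).

Definition lfrac : Type := (R * denom)%type.
HB.instance Definition _ := Choice.on lfrac.
Implicit Types x y z : lfrac.

Definition frac_eq x y : Prop :=
  exists u : denom, val u * (x.1 * val y.2 - y.1 * val x.2) = 0.

Definition frac_eqb x y : bool := `[< frac_eq x y >].

Lemma frac_eqb_refl : reflexive frac_eqb.
Proof. by move=> x; apply/asboolP; exists den1; rewrite subrr mulr0. Qed.

Lemma frac_eqb_sym : symmetric frac_eqb.
Proof.
move=> x y; apply/asboolP/asboolP => -[u e]; exists u;
  by rewrite -opprB mulrN e oppr0.
Qed.

Lemma frac_eqb_trans : transitive frac_eqb.
Proof.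
move=> [b t] [a s] [c w] /asboolP[u /= eu] /asboolP[v /= ev]; apply/asboolP.
exists (den_mul (den_mul u v) t) => /=.
have -> : val u * val v * val t * (a * val w - c * val s) =
    val v * val w * (val u * (a * val t - b * val s))
    + val u * val s * (val v * (b * val w - c * val t)) by ring.
by rewrite eu ev !mulr0 addr0.
Qed.

Canonical frac_equiv :=
  EquivRel frac_eqb frac_eqb_refl frac_eqb_sym frac_eqb_trans.

Definition loc : Type := {eq_quot frac_eqb}.
HB.instance Definition _ : EqQuotient _ frac_eqb loc := EqQuotient.on loc.
HB.instance Definition _ := Choice.on loc.

Definition mk_loc x : loc := \pi x.

Lemma mk_locP x y : mk_loc x = mk_loc y <-> frac_eq x y.
Proof.
split => [/eqmodP/asboolP //|exy].
by apply/eqmodP/asboolP.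
Qed.

Lemma mk_loc_repr (a : loc) : mk_loc (repr a) = a.
Proof. exact: reprK. Qed.

Lemma frac_eq_repr x : frac_eq (repr (mk_loc x)) x.
Proof. by apply/mk_locP; rewrite mk_loc_repr. Qed.

Lemma mk_loc_surj (a : loc) : exists x, a = mk_loc x.
Proof. by exists (repr a); rewrite mk_loc_repr. Qed.

Definition frac_add x y : lfrac :=
  (x.1 * val y.2 + y.1 * val x.2, den_mul x.2 y.2).
Definition frac_opp x : lfrac := (- x.1, x.2).
Definition frac_mul x y : lfrac := (x.1 * y.1, den_mul x.2 y.2).

Definition loc_add (a b : loc) : loc := mk_loc (frac_add (repr a) (repr b)).
Definition loc_opp (a : loc) : loc := mk_loc (frac_opp (repr a)).
Definition loc_mul (a b : loc) : loc := mk_loc (frac_mul (repr a) (repr b)).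
Definition loc0 : loc := mk_loc (0, den1).
Definition loc1 : loc := mk_loc (1, den1).

Lemma loc_addE x y : loc_add (mk_loc x) (mk_loc y) = mk_loc (frac_add x y).
Proof.
apply/mk_locP.
have [u] := frac_eq_repr x; have [v] := frac_eq_repr y.
move: (repr (mk_loc x)) (repr (mk_loc y)) => [a' s'] [b' t'].
move: x y => [a s] [b t] /= ev eu.
exists (den_mul u v) => /=.
have -> : val u * val v * ((a' * val t' + b' * val s') * (val s * val t)
      - (a * val t + b * val s) * (val s' * val t')) =
    val v * val t' * val t * (val u * (a' * val s - a * val s'))
    + val u * val s' * val s * (val v * (b' * val t - b * val t')) by ring.
by rewrite eu ev !mulr0 addr0.
Qed.

Lemma loc_mulE x y : loc_mul (mk_loc x) (mk_loc y) = mk_loc (frac_mul x y).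
Proof.
apply/mk_locP.
have [u] := frac_eq_repr x; have [v] := frac_eq_repr y.
move: (repr (mk_loc x)) (repr (mk_loc y)) => [a' s'] [b' t'].
move: x y => [a s] [b t] /= ev eu.
exists (den_mul u v) => /=.
have -> : val u * val v * ((a' * b') * (val s * val t)
      - (a * b) * (val s' * val t')) =
    val v * b' * val t * (val u * (a' * val s - a * val s'))
    + val u * val s' * a * (val v * (b' * val t - b * val t')) by ring.
by rewrite eu ev !mulr0 addr0.
Qed.

Lemma loc_oppE x : loc_opp (mk_loc x) = mk_loc (frac_opp x).
Proof.
apply/mk_locP; have [u eu] := frac_eq_repr x; exists u => /=.
by rewrite !mulNr -opprD mulrN eu oppr0.
Qed.

Lemma mk_loc_eq x y : x.1 * val y.2 = y.1 * val x.2 -> mk_loc x = mk_loc y.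
Proof. by move=> e; apply/mk_locP; exists den1; rewrite e subrr mulr0. Qed.

Lemma loc_addA : associative loc_add.
Proof.
move=> a b c; move: (mk_loc_surj a) (mk_loc_surj b) (mk_loc_surj c).
move=> [x ->] [y ->] [z ->].
by rewrite !loc_addE; apply: mk_loc_eq => /=; ring.
Qed.

Lemma loc_addC : commutative loc_add.
Proof.
move=> a b; move: (mk_loc_surj a) (mk_loc_surj b) => [x ->] [y ->].
by rewrite !loc_addE; apply: mk_loc_eq => /=; ring.
Qed.

Lemma loc_add0 : left_id loc0 loc_add.
Proof.
move=> a; have [x ->] := mk_loc_surj a.
by rewrite /loc0 !loc_addE; apply: mk_loc_eq => /=; ring.
Qed.

Lemma loc_addN : left_inverse loc0 loc_opp loc_add.
Proof.
move=> a; have [x ->] := mk_loc_surj a.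
by rewrite /loc0 loc_oppE loc_addE; apply: mk_loc_eq => /=; ring.
Qed.

Lemma loc_mulA : associative loc_mul.
Proof.
move=> a b c; move: (mk_loc_surj a) (mk_loc_surj b) (mk_loc_surj c).
move=> [x ->] [y ->] [z ->].
by rewrite !loc_mulE; apply: mk_loc_eq => /=; ring.
Qed.

Lemma loc_mulC : commutative loc_mul.
Proof.
move=> a b; move: (mk_loc_surj a) (mk_loc_surj b) => [x ->] [y ->].
by rewrite !loc_mulE; apply: mk_loc_eq => /=; ring.
Qed.

Lemma loc_mul1 : left_id loc1 loc_mul.
Proof.
move=> a; have [x ->] := mk_loc_surj a.
by rewrite /loc1 !loc_mulE; apply: mk_loc_eq => /=; ring.
Qed.

Lemma loc_mulD : left_distributive loc_mul loc_add.
Proof.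
move=> a b c; move: (mk_loc_surj a) (mk_loc_surj b) (mk_loc_surj c).
move=> [x ->] [y ->] [z ->].
by rewrite !(loc_addE, loc_mulE); apply: mk_loc_eq => /=; ring.
Qed.

Lemma loc1_neq0 : loc1 != loc0.
Proof.
apply/eqP => /mk_locP[u] /=; rewrite !mulr1 subr0 mulr1 => u0.
case: (spec_prime p) => -[[p0 _ _] _] _.
by have := @denP u; rewrite /= u0.
Qed.

HB.instance Definition _ :=
  GRing.isZmodule.Build loc loc_addA loc_addC loc_add0 loc_addN.
HB.instance Definition _ :=
  GRing.Zmodule_isComNzRing.Build loc
    loc_mulA loc_mulC loc_mul1 loc_mulD loc1_neq0.

Definition to_loc (a : R) : loc := mk_loc (a, den1).

Lemma to_loc_is_zmod_morphism : zmod_morphism to_loc.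
Proof.
move=> a b; rewrite /to_loc [- _ in RHS]loc_oppE [RHS]loc_addE.
by apply: mk_loc_eq => /=; ring.
Qed.

Lemma to_loc_is_monoid_morphism : monoid_morphism to_loc.
Proof.
split=> // a b; rewrite /to_loc [RHS]loc_mulE.
by apply: mk_loc_eq => /=; ring.
Qed.

HB.instance Definition _ :=
  GRing.isZmodMorphism.Build R loc to_loc to_loc_is_zmod_morphism.
HB.instance Definition _ :=
  GRing.isMonoidMorphism.Build R loc to_loc to_loc_is_monoid_morphism.

(* The extended ideal I_p = I R_p. *)
Definition loc_ideal (I : set R) : set loc := ideal_gen (to_loc @` I).

End Localization.

Arguments to_loc {R} p a.
Arguments loc_ideal {R} p I.

Definition cohen_macaulay (R : comNzRingType) : Prop :=
  noetherian R /\
  forall m : spec R, maximal_ideal m -> cohen_macaulay_local (loc m).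

Definition generically_complete_intersection
    (R : comNzRingType) (I : set R) : Prop :=
  forall p : spec R, minimal_prime I p -> complete_intersection (loc_ideal p I).

(* Main.v *)
Require Import Defs.
From mathcomp Require Import all_boot all_algebra.
From mathcomp Require Import perm boolp classical_sets ring.

(** The inclusion of [sqrt I] in [IL : L^2] always holds, because [L sqrt I] is
    inside [I]. The theorem therefore says that [I] is integrally closed exactly
    when nothing outside [sqrt I] multiplies [L^2] into [IL].

    Suppose [I] is integrally closed and [r L^2 <= IL]. By the determinant trick
    ([integral_of_mul_sub]) every element of [r L] is integral over [I], so
    [r L <= I]. If [r] were not in [sqrt I], some associated prime [P = I : x]
    would miss [r]; but [x] is in [L], since [sqrt I <= P], so [r x] is in [I] and
    [r] is in [P] after all ([colon_sub_radical]).

    Suppose [I] is not integrally closed, and let [z] outside [I] be integral over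
    [I]. Some associated prime [P] of [I] is of the form [I : c z], so that [z] is
    not in [I R_P]; by unmixedness [P] is minimal over [I]
    ([unmixed_associated_minimal]). In [R_P] the ideal [J = I R_P] is generated by
    a regular sequence [x_1, ..., x_d], is primary to the maximal ideal [M], and is
    not integrally closed. It is then enough to see that [(J : M)^2 <= J (J : M)]
    ([link_square]): as [L R_P = J : M] and [L^2] is finitely generated, clearing
    denominators gives [r] outside [P], hence outside [sqrt I], with [r L^2 <= IL].

    The local inclusion rests on a dichotomy. If some [a y] with [a] in [M] and [y]
    in [J : M] has a unit coefficient at some [x_j], then modulo the other [x_i] the
    ring is a discrete valuation ring with uniformizer [a], and [J], being the
    preimage of a power of [(a)], is integrally closed
    ([integrally_closed_of_minimal_product]). This is excluded, so
    [M (J : M) <= M J]. Writing [y1 y2 = sum_i c_i x_i] with [y1], [y2] in [J : M]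
    and comparing coefficients in [a y1 y2] for [a] in [M], one gets that the [c_i]
    are in [J : M]. Both halves use that the coefficients of a relation on a regular
    sequence are combinations of the other terms ([regular_relation]). *)

Set Implicit Arguments.
Unset Strict Implicit.
Unset Printing Implicit Defensive.

Import GRing.Theory.
Local Open Scope classical_set_scope.
Local Open Scope ring_scope.

(** * Ideals and their generators *)

Section IdealBasics.
Variable R : comNzRingType.
Implicit Types (A B I J P : set R).

Lemma ideal0 I : is_ideal I -> I 0. Proof. by case. Qed.

Lemma idealD I x y : is_ideal I -> I x -> I y -> I (x + y).
Proof. by case=> _ D _; apply: D. Qed.

Lemma ideal_mull I a x : is_ideal I -> I x -> I (a * x).
Proof. by case=> _ _; apply. Qed.

Lemma ideal_mulr I a x : is_ideal I -> I x -> I (x * a).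
Proof. by rewrite mulrC; apply: ideal_mull. Qed.

Lemma idealN I x : is_ideal I -> I x -> I (- x).
Proof. by rewrite -mulN1r; apply: ideal_mull. Qed.

Lemma idealB I x y : is_ideal I -> I x -> I y -> I (x - y).
Proof. by move=> II Ix Iy; apply: idealD => //; apply: idealN. Qed.

Lemma ideal_sum I (T : Type) (r : seq T) (Q : pred T) (F : T -> R) :
  is_ideal I -> (forall i, Q i -> I (F i)) -> I (\sum_(i <- r | Q i) F i).
Proof.
move=> II IF; elim/big_rec: _ => [|i x Qi Ix]; first exact: ideal0.
by apply: idealD => //; apply: IF.
Qed.

Lemma is_ideal_setT : is_ideal (@setT R).
Proof. by []. Qed.

Lemma is_ideal_colon A B : is_ideal A -> is_ideal (colon A B).
Proof.
move=> IA; split=> [b _|x y Ax Ay b Bb|a x Ax b Bb].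
  by rewrite mul0r; apply: ideal0.
  by rewrite mulrDl; apply: idealD; [|apply: Ax|apply: Ay].
by rewrite -mulrA; apply: ideal_mull => //; apply: Ax.
Qed.

Lemma is_ideal_gen A : is_ideal (ideal_gen A).
Proof.
split=> [J [IJ _]|x y Ax Ay J [IJ AJ]|a x Ax J [IJ AJ]]; first exact: ideal0.
  by apply: idealD; [|apply: Ax|apply: Ay].
by apply: ideal_mull => //; apply: Ax.
Qed.

Lemma ideal_gen_sub A J : is_ideal J -> A `<=` J -> ideal_gen A `<=` J.
Proof. exact: smallest_sub. Qed.

Lemma sub_ideal_gen A : A `<=` ideal_gen A.
Proof. exact: sub_gen_smallest. Qed.

Lemma is_ideal_mul A B : is_ideal (ideal_mul A B).
Proof. exact: is_ideal_gen. Qed.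

Lemma mem_ideal_mul A B x y : A x -> B y -> ideal_mul A B (x * y).
Proof. by move=> Ax By; apply: sub_ideal_gen; exists x, y. Qed.

Lemma ideal_mul_sub A B J : is_ideal J ->
  (forall x y, A x -> B y -> J (x * y)) -> ideal_mul A B `<=` J.
Proof.
by move=> IJ H; apply: ideal_gen_sub => // _ [x [y [Ax By ->]]]; apply: H.
Qed.

Lemma is_ideal_exp I n : is_ideal (ideal_exp I n).
Proof. by case: n => [|n]; [apply: is_ideal_setT|apply: is_ideal_mul]. Qed.

Lemma mem_ideal_exp1 I x : I x -> ideal_exp I 1 x.
Proof. by move=> Ix; rewrite -[x]mulr1; apply: mem_ideal_mul. Qed.

Lemma ideal_expS_sub I n : is_ideal I -> ideal_exp I n.+1 `<=` I.
Proof. by move=> II; apply: ideal_mul_sub => // x y Ix _; apply: ideal_mulr. Qed.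

Lemma ideal_expD I m n x y :
  ideal_exp I m x -> ideal_exp I n y -> ideal_exp I (m + n) (x * y).
Proof.
move=> Imx Iny; elim: m x Imx => [|m IHm] x.
  by move=> _; apply: ideal_mull => //; apply: is_ideal_exp.
suff: ideal_exp I m.+1 `<=` [set x | ideal_exp I (m.+1 + n) (x * y)] by apply.
apply: ideal_mul_sub => [|a b Ia Imb].
  split=> [|u v Iu Iv|a u Iu]; rewrite /mkset.
  - by rewrite mul0r; apply: (ideal0 (is_ideal_exp I _)).
  - by rewrite mulrDl; apply: (idealD (is_ideal_exp I _)).
  - by rewrite -mulrA; apply: (ideal_mull _ (is_ideal_exp I _)).
by rewrite /= -mulrA; apply: mem_ideal_mul => //; apply: IHm.
Qed.

Lemma ideal_exp_leq I m n : (m <= n)%N -> ideal_exp I n `<=` ideal_exp I m.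
Proof.
move=> /subnKC <-; elim: (n - m)%N => [|k IHk]; first by rewrite addn0.
rewrite addnS; apply: subset_trans IHk.
by apply: ideal_mul_sub => [|a b _]; [|apply: ideal_mull]; apply: is_ideal_exp.
Qed.

(** The ideal [A] is put in front of the span so that the same expansion covers
    a finitely generated ideal ([A] the unit ideal) and a product [A * (s)]. *)
Lemma ideal_mul_genP A (s : seq R) x : is_ideal A ->
  ideal_mul A (ideal_gen [set` s]) x <->
  exists c : nat -> R, (forall i, A (c i)) /\ x = \sum_(i < size s) c i * s`_i.
Proof.
move=> IA; split=> [|[c [Ac ->]]]; last first.
  apply: ideal_sum => [|i _]; first exact: is_ideal_mul.
  by apply: mem_ideal_mul => //; apply: sub_ideal_gen => /=; rewrite mem_nth.
pose D : set R := [set x | exists c : nat -> R,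
  (forall i, A (c i)) /\ x = \sum_(i < size s) c i * s`_i].
have ID : is_ideal D.
  split=> [|_ _ [c [Ac ->]] [d [Ad ->]]|a _ [c [Ac ->]]].
  - exists (fun=> 0); split=> [_|]; first exact: ideal0.
    by rewrite big1 // => i _; rewrite mul0r.
  - exists (fun i => c i + d i); split=> [i|]; first exact: idealD.
    by rewrite -big_split; apply: eq_bigr => i _; rewrite mulrDl.
  - exists (fun i => a * c i); split=> [i|]; first exact: ideal_mull.
    by rewrite mulr_sumr; apply: eq_bigr => i _; rewrite mulrA.
suff: ideal_mul A (ideal_gen [set` s]) `<=` D by apply.
apply: ideal_mul_sub => // a y Aa.
suff: ideal_gen [set` s] `<=` [set y | D (a * y)] by apply.
apply: ideal_gen_sub => [|{}y /= ys].
  split=> [|u v|b u] /=; first by rewrite mulr0; apply: ideal0.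
    by rewrite mulrDr; apply: idealD.
  by rewrite mulrCA; apply: ideal_mull.
have ltys : (index y s < size s)%N by rewrite index_mem.
exists (fun i => a *+ (i == index y s)); split=> [i|].
  by case: eqP => _; rewrite ?mulr1n ?mulr0n //; apply: ideal0.
rewrite (bigD1 (Ordinal ltys)) //= eqxx mulr1n nth_index // big1 ?addr0 //.
move=> i; rewrite -val_eqE /= => /negPf ->; by rewrite mulr0n mul0r.
Qed.

Lemma ideal_mulTl J : is_ideal J -> ideal_mul setT J = J.
Proof.
move=> IJ; apply/seteqP; split.
  by apply: ideal_mul_sub => // x y _; apply: ideal_mull.
by move=> x Jx; rewrite -[x]mul1r; apply: mem_ideal_mul.
Qed.

Lemma ideal_genP (s : seq R) x : ideal_gen [set` s] x <->
  exists c : nat -> R, x = \sum_(i < size s) c i * s`_i.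
Proof.
rewrite -[ideal_gen _]ideal_mulTl; last exact: is_ideal_gen.
rewrite ideal_mul_genP //; split=> [[c [_ ->]]|[c ->]]; first by exists c.
by exists c.
Qed.

End IdealBasics.

(** * Associated primes in a Noetherian ring *)

Section Noetherian.
Variable R : comNzRingType.
Implicit Types (A B I J P T : set R).

(** By Zorn's lemma: a nonempty chain of ideals contains its union, since the
    finitely many generators of the union all lie in one member of the chain. *)
Lemma noetherian_max (F : set (set R)) : noetherian R ->
  F !=set0 -> (forall I, F I -> is_ideal I) ->
  exists2 J, F J & forall I, F I -> J `<=` I -> I = J.
Proof.
move=> noeR [I0 FI0] FI.
have [|M [[M0|FM] maxM]] := @Zorn_bigcup _ [set X | X = set0 \/ F X].
(* The empty set joins the family so that the empty chain has an upper bound. *)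
- move=> C CF totC; have [/eqP|/set0P[x [X CX Xx]]] := eqVneq (\bigcup_(X in C) X) set0.
    by move/eqP; left.
  right; have FX : F X by case: (CF _ CX) => // X0; rewrite X0 in Xx.
  have IU : is_ideal (\bigcup_(X in C) X).
    have FC Y y : C Y -> Y y -> is_ideal Y.
      by move=> CY Yy; apply: FI; case: (CF _ CY) => // Y0; rewrite Y0 in Yy.
    split=> [|y z [Y CY Yy] [Z CZ Zz]|a y [Y CY Yy]].
    + by exists X => //; apply: (ideal0 (FI _ FX)).
    + case: (totC Y Z CY CZ) => le.
        by exists Z => //; apply: idealD => //; [apply: (FC _ z)|apply: le].
      by exists Y => //; apply: idealD => //; [apply: (FC _ y)|apply: le].
    + by exists Y => //; apply: ideal_mull => //; apply: (FC _ y).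
  have [s Us] := noeR _ IU.
  have [Y CY sY] : exists2 Y, C Y & [set` s] `<=` Y.
    have : [set` s] `<=` \bigcup_(X in C) X by rewrite Us; apply: sub_ideal_gen.
    elim: s {Us} => [|y s IHs] sU; first by exists X.
    have [|Y CY sY] := IHs; first by move=> z zs; apply: sU; rewrite /= inE zs orbT.
    have [|Z CZ Zy] := sU y; first by rewrite /= inE eqxx.
    case: (totC Y Z CY CZ) => le.
      by exists Z => // z /=; rewrite inE => /predU1P[->|/sY/le].
    by exists Y => // z /=; rewrite inE => /predU1P[->|/sY//]; apply: le.
  have [Y0|FY] := CF _ CY; last first.
    suff -> : \bigcup_(X in C) X = Y by [].
    apply/seteqP; split; last by move=> y Yy; exists Y.
    by rewrite Us; apply: ideal_gen_sub => //; apply: FI.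
  have s0 : s = [::].
    by case: s {Us} sY => // y s /(_ y); rewrite Y0 /= inE eqxx => /(_ isT).
  suff -> : \bigcup_(X in C) X = X by [].
  apply/seteqP; split; last by move=> y Xy; exists X.
  by rewrite Us s0; apply: ideal_gen_sub => //; apply: FI.
- exfalso; apply: (maxM I0); last by right.
  rewrite M0 properEneq; split=> //; apply/eqP => I00.
  by have := ideal0 (FI _ FI0); rewrite -I00.
exists M => // I FI' MI; apply: contrapT => neq; apply: (maxM I); last by right.
by rewrite properEneq; split=> //; apply/eqP => e; apply: neq.
Qed.

Definition mult_set T : Prop := T 1 /\ forall x y, T x -> T y -> T (x * y).

Lemma common_multiplier T A B : noetherian R -> mult_set T ->
  is_ideal A -> is_ideal B ->
  (forall x, A x -> exists2 t, T t & B (t * x)) ->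
  exists2 t, T t & forall x, A x -> B (t * x).
Proof.
move=> noeR [T1 TM] IA IB AB; have [s As] := noeR _ IA.
have sA : [set` s] `<=` A by rewrite As; apply: sub_ideal_gen.
suff [t Tt tB] : exists2 t, T t & forall x, x \in s -> B (t * x).
  exists t => // x; rewrite As.
  suff: ideal_gen [set` s] `<=` [set x | B (t * x)] by apply.
  apply: ideal_gen_sub => //; split=> [|y z|a y] /=.
  - by rewrite mulr0; apply: ideal0.
  - by rewrite mulrDr; apply: idealD.
  - by rewrite mulrCA; apply: ideal_mull.
elim: s {As} sA => [|y s IHs] sA; first by exists 1.
have [|t Tt tB] := IHs; first by move=> z zs; apply: sA; rewrite /= inE zs orbT.
have [|u Tu uB] := AB y; first by apply: sA; rewrite /= inE eqxx.
exists (t * u); first exact: TM.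
move=> z; rewrite inE => /predU1P[->|/tB Bz]; last by rewrite mulrAC; apply: ideal_mulr.
by rewrite -mulrA; apply: ideal_mull.
Qed.

(** Among the ideals [(I_T : x)] with [x] a multiple of [z] outside the
    [T]-saturation [I_T] of [I], a maximal one is prime and misses [T]; since it
    is finitely generated, one element of [T] clears all denominators and turns
    it into a colon ideal of [I] itself. *)
Lemma associated_prime_avoiding T I z : noetherian R -> is_ideal I ->
  mult_set T -> (forall t, T t -> ~ I (t * z)) ->
  exists c, associated_prime I (colon I [set c * z]) /\
            (forall t, T t -> ~ colon I [set c * z] t).
Proof.
move=> noeR II multT zI; have [T1 TM] := multT.
pose Q x : set R := [set r | exists2 t, T t & I (t * (r * x))].
have IQ x : is_ideal (Q x).
  split=> [|r r' [t Tt It] [t' Tt' It']|a r [t Tt It]].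
  - by exists 1 => //; rewrite mul0r mulr0; apply: ideal0.
  - exists (t * t'); first exact: TM.
    have -> : t * t' * ((r + r') * x) =
      t' * (t * (r * x)) + t * (t' * (r' * x)) by ring.
    by apply: idealD => //; apply: ideal_mull.
  - exists t => //; have -> : t * (a * r * x) = a * (t * (r * x)) by ring.
    exact: ideal_mull.
pose bad x := (exists c, x = c * z) /\ forall t, T t -> ~ I (t * x).
have [||_ [x [[c xE] xI] ->] maxQ] :=
  @noetherian_max [set J | exists2 x, bad x & J = Q x] noeR.
- by exists (Q z), z => //; split=> //; exists 1; rewrite mul1r.
- by move=> _ [x _ ->].
have TQ t : T t -> ~ Q x t.
  by move=> Tt [t' Tt' It]; apply: (xI (t' * t)); [apply: TM|rewrite -mulrA].
have primeQ : prime_ideal (Q x).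
  split=> [|r r' Qrr']; first by split=> // QT; apply: (TQ 1 T1); rewrite QT.
  have [Qr|nQr] := pselect (Q x r); [by left|right].
  suff <- : Q (r * x) = Q x.
    by case: Qrr' => t Tt It; exists t => //; rewrite [r' * _]mulrA [r' * r]mulrC.
  apply: maxQ.
    exists (r * x) => //; split=> [|t Tt It]; first by exists (r * c); rewrite xE mulrA.
    by apply: nQr; exists t.
  move=> a [t Tt It]; exists t => //.
  have -> : t * (a * (r * x)) = r * (t * (a * x)) by ring.
  exact: ideal_mull.
have [t Tt tQ] : exists2 t, T t & forall r, Q x r -> [set r | I (r * x)] (t * r).
  apply: common_multiplier => //.
    split=> [|a b|a b] /=; first by rewrite mul0r; apply: ideal0.
      by rewrite mulrDl; apply: idealD.
    by rewrite -mulrA; apply: ideal_mull.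
  by move=> r [t Tt It]; exists t => //=; rewrite -mulrA.
have QE : Q x = colon I [set t * c * z].
  apply/seteqP; split=> r.
    by move=> /tQ /= Ir _ ->; rewrite -mulrA -xE mulrCA mulrA.
  move=> /(_ _ erefl) Ir; exists t => //.
    by have <- : r * (t * c * z) = t * (r * x) by rewrite xE; ring.
exists (t * c); rewrite -QE; split=> //; split=> //.
by exists (t * c * z).
Qed.

End Noetherian.

(** * Integral dependence *)

Section DeterminantTrick.
Variable R : comNzRingType.
Implicit Types (I L : set R) (p q : {poly R}).

(** The polynomials that have degree [m] once a coefficient in [I] is counted as
    having degree one. As the subtraction is truncated, nothing is asked of the
    coefficients above [m]. *)
Definition rees_graded I m : set {poly R} :=
  [set p | forall k, ideal_exp I (m - k) p`_k].

Lemma rees_gradedM I m n p q :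
  rees_graded I m p -> rees_graded I n q -> rees_graded I (m + n) (p * q).
Proof.
move=> pI qI k; rewrite coefM; apply: ideal_sum => [|i _]; first exact: is_ideal_exp.
apply: (ideal_exp_leq _ (ideal_expD (pI i) (qI (k - i)%N))).
by rewrite leq_subLR -{1}(subnKC (leq_ord i)) addnACA leq_add // -leq_subLR.
Qed.

(** Every entry of [X - A] has degree one in this grading, and the determinant is
    a signed sum of [n]-fold products of entries. *)
Lemma char_poly_graded I n (A : 'M[R]_n) : is_ideal I ->
  (forall i j, I (A i j)) -> rees_graded I n (char_poly A).
Proof.
move=> II IA k; rewrite coef_sum; apply: ideal_sum => [|s _]; first exact: is_ideal_exp.
rewrite -signr_odd; set b := odd _; have -> : (-1) ^+ b = ((-1) ^+ b : R)%:P.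
  by rewrite rmorphXn rmorphN1.
rewrite coefCM; apply: ideal_mull; first exact: is_ideal_exp.
rewrite -{1}[n](card_ord n) -sum1_card.
suff: rees_graded I (\sum_(i in 'I_n) 1) (\prod_i char_poly_mx A i (s i)) by apply.
elim/big_rec2: _ => [j|i m p _ Ip]; first by rewrite sub0n.
rewrite mulrC addnC; apply: rees_gradedM => // -[|[|j]]; rewrite ?subn0 ?subnn //.
- rewrite !mxE coefB coefMn coefX mul0rn sub0r coefC /=.
  by apply: mem_ideal_exp1; apply: idealN.
Qed.

(** The determinant trick: [w] acts on the generators of [L] by a matrix over
    [I], whose characteristic polynomial, evaluated at [w], kills [L]; as [w] is
    in [L], multiplying once more by [w] gives an integral equation even when [L]
    has annihilators. *)
Lemma integral_of_mul_sub I L w : noetherian R -> is_ideal I -> is_ideal L ->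
  L w -> (forall x, L x -> ideal_mul I L (w * x)) -> integral_closure I w.
Proof.
move=> noeR II IL Lw wL; have [s Ls] := noeR _ IL; set n := size s.
have sL (i : 'I_n) : L s`_i.
  by rewrite Ls; apply: sub_ideal_gen => /=; rewrite mem_nth.
have /choice[c cP] (i : 'I_n) : exists c : nat -> R,
    (forall j, I (c j)) /\ w * s`_i = \sum_(j < n) c j * s`_j.
  by apply/(ideal_mul_genP s _ II); rewrite -Ls; apply: wL.
pose A : 'M[R]_n := \matrix_(i, j) c i j.
pose p := char_poly A.
have pw_s (i : 'I_n) : p.[w] * s`_i = 0.
  pose v : 'cV[R]_n := \col_i s`_i.
  pose B := w%:M - A.
  have Bv : B *m v = 0.
    apply/matrixP => j k; rewrite mulmxBl mul_scalar_mx !mxE.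
    have [_ ->] := cP j; apply/eqP; rewrite subr_eq0; apply/eqP.
    by apply: eq_bigr => l _; rewrite !mxE.
  have detB : \det B = p.[w].
    rewrite /p /char_poly -horner_evalE -det_map_mx; congr (\det _).
    by apply/matrixP => j k; rewrite !mxE /= horner_evalE !hornerE hornerMn hornerX.
  have := congr1 (fun M => (\adj B *m M) i 0) Bv.
  by rewrite /= mulmxA mul_adj_mx detB mul_scalar_mx mulmx0 !mxE.
have pww : p.[w] * w = 0.
  have : ideal_gen [set` s] w by rewrite -Ls.
  move=> /ideal_genP[d wE]; rewrite {2}wE mulr_sumr big1 // => i _.
  by rewrite mulrCA pw_s mulr0.
have size_p : size p = n.+1 by exact: size_char_poly.
have lead_p : p`_n = 1.
  by have /monicP := char_poly_monic A; rewrite lead_coefE -/p size_p.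
exists n.+1, (fun i => if (i <= n)%N then p`_(n - i) else 0); split=> // [i /andP[i0 _]|].
  case: leqP => [lein|_]; last by apply: ideal0; apply: is_ideal_exp.
  have := char_poly_graded II (A := A) (fun i j => _) (n - i)%N.
  rewrite subKn //; apply => j k; rewrite mxE; exact: (cP j).1.
rewrite -[RHS]pww horner_coef size_p big_ord_recr /= lead_p mul1r mulrDl addrC.
congr (_ + _); last by rewrite exprSr.
rewrite big_nat_recr //= ltnn mul0r addr0 big_add1 /= big_mkord mulr_suml.
rewrite (reindex_inj rev_ord_inj) /=; apply: eq_bigr => i _.
rewrite subnSK // leq_subr subSn ?leq_subr // subKn; last exact: ltnW.
by rewrite exprSr mulrA.
Qed.

End DeterminantTrick.

(** * Relations on a regular sequence *)

Section RegularSequences.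
Variable R : comNzRingType.
Implicit Types (s : seq R).

(** A relation on a regular sequence is a combination of the Koszul relations.
    This replaces the permutability of regular sequences, which would need the
    ring to be local and Noetherian: by this lemma each [x_j] is a nonzerodivisor
    modulo all the other terms, in any ring. *)
Lemma regular_relation (x : nat -> R) d (c : nat -> R) :
  (forall i, (i < d)%N -> forall y,
     (exists e : nat -> R, x i * y = \sum_(k < i) e k * x k) ->
     exists e : nat -> R, y = \sum_(k < i) e k * x k) ->
  \sum_(i < d) c i * x i = 0 ->
  forall j, (j < d)%N ->
    exists e : nat -> R, c j = \sum_(i < d | i != j :> nat) e i * x i.
Proof.
elim: d c => // d IHd c reg; rewrite big_ord_recr /= => /eqP.
rewrite addrC addr_eq0 => /eqP cd j; rewrite ltnS leq_eqVlt.
have [|e cdE] := reg d (ltnSn d) (c d).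
  by exists (fun i => - c i); rewrite mulrC cd -sumrN; apply: eq_bigr => i _; rewrite mulNr.
move=> /predU1P[->|ltjd].
  exists e; rewrite cdE [RHS]big_mkcond big_ord_recr /= eqxx addr0.
  by apply: eq_bigr => i _; rewrite neq_ltn ltn_ord.
have [||f cjE] := IHd (fun i => c i + e i * x d) _ _ j ltjd.
- by move=> i ltid; apply: reg; apply: ltnW.
- rewrite -[RHS](subrr (c d * x d)) {2}cd opprK addrC {1}cdE mulr_suml -big_split.
  by apply: eq_bigr => i _; rewrite mulrDl mulrAC.
exists (fun i => if i == d then - e j else f i).
rewrite big_mkcond big_ord_recr /= eqxx gtn_eqF // mulNr -big_mkcond /=.
rewrite -[LHS](addrK (e j * x d)) cjE; congr (_ - _).
by apply: eq_bigr => i _; rewrite ltn_eqF.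
Qed.

End RegularSequences.

(** * Complete intersections in a local ring *)

Section LocalRing.
Variables (S : comNzRingType) (M : set S).
Hypotheses (IM : is_ideal M) (M1 : ~ M 1).
Hypothesis unitM : forall x, ~ M x -> exists y, y * x = 1.
Implicit Types (K J : set S) (s : seq S).

Lemma local_prime x y : M (x * y) -> ~ M x -> M y.
Proof.
move=> Mxy /unitM[u ux]; rewrite -[y]mul1r -ux -mulrA.
exact: ideal_mull.
Qed.

Lemma local_primeX x n : M (x ^+ n) -> M x.
Proof.
elim: n => [|n IHn]; rewrite ?expr0 // exprS => Mx.
by apply: contrapT => nMx; apply/nMx/IHn; apply: local_prime Mx nMx.
Qed.

Lemma integral_closure_sub_max J : is_ideal J -> J `<=` M -> integral_closure J `<=` M.
Proof.
move=> IJ JM z [n [a [n0 aJ /eqP]]]; rewrite addr_eq0 => /eqP zn.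
apply: (@local_primeX _ n); rewrite zn; apply/(idealN IM).
rewrite big_nat_cond; apply: ideal_sum => // -[|i]; rewrite andbT // => le_in.
have aiJ := aJ _ le_in.
by apply: (ideal_mulr _ IM); apply: JM; apply: ideal_expS_sub aiJ.
Qed.

Section PrincipalModulo.
Variables (K : set S) (a : S).
Hypotheses (IK : is_ideal K) (KM : K `<=` M) (Ma : M a).
Hypothesis maxE : forall b, M b -> exists c, K (b - c * a).
Hypothesis a_reg : forall y, K (a * y) -> K y.

Definition add_power m : set S := [set x | exists c, K (x - c * a ^+ m)].

Lemma is_ideal_add_power m : is_ideal (add_power m).
Proof.
split=> [|x y [c Kx] [d Ky]|b x [c Kx]].
- by exists 0; rewrite mul0r subrr; apply: ideal0.
- exists (c + d); have -> : x + y - (c + d) * a ^+ m =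
    (x - c * a ^+ m) + (y - d * a ^+ m) by ring.
  exact: idealD.
- exists (b * c); have -> : b * x - b * c * a ^+ m = b * (x - c * a ^+ m) by ring.
  exact: ideal_mull.
Qed.

Lemma add_power_mul m n x y :
  add_power m x -> add_power n y -> add_power (m + n) (x * y).
Proof.
move=> [c Kx] [d Ky]; exists (c * d).
have -> : x * y - c * d * a ^+ (m + n) =
  y * (x - c * a ^+ m) + (c * a ^+ m) * (y - d * a ^+ n) by rewrite exprD; ring.
by apply: idealD => //; apply: ideal_mull.
Qed.

Lemma add_power_leq m n : (m <= n)%N -> add_power n `<=` add_power m.
Proof.
by move=> /subnK <- x [c Kx]; exists (c * a ^+ (n - m)); rewrite -mulrA -exprD.
Qed.

Lemma add_powerX m n x : add_power m x -> add_power (m * n) (x ^+ n).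
Proof.
move=> Fx; elim: n => [|n IHn].
  by exists 1; rewrite muln0 !expr0 mul1r subrr; apply: ideal0.
by rewrite mulnS exprS; apply: add_power_mul.
Qed.

Lemma add_power_exp m n : ideal_exp (add_power m) n `<=` add_power (m * n).
Proof.
elim: n => [|n IHn].
  by move=> x _; exists x; rewrite muln0 expr0 mulr1 subrr; apply: ideal0.
apply: ideal_mul_sub; first exact: is_ideal_add_power.
by move=> x y Fx /IHn Fy; rewrite mulnS; apply: add_power_mul.
Qed.

Lemma unit_power_expansion n x : add_power n x \/
  exists t v, [/\ (t < n)%N, ~ M v & K (x - v * a ^+ t)].
Proof.
elim: n => [|n [[c Kx]|[t [v [lt_tn nMv Kx]]]]].
- by left; exists x; rewrite expr0 mulr1 subrr; apply: ideal0.
- have [Mc|nMc] := pselect (M c); last by right; exists n, c.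
  have [e Kc] := maxE Mc; left; exists e.
  have -> : x - e * a ^+ n.+1 = (x - c * a ^+ n) + a ^+ n * (c - e * a).
    by rewrite exprS; ring.
  by apply: idealD => //; apply: ideal_mull.
- by right; exists t, v; rewrite ltnW.
Qed.

(** [S / K] behaves like a discrete valuation ring with uniformizer [a]: an
    element of valuation [t < m] cannot be integral over [(a ^+ m)], since in an
    integral equation of degree [n] the leading term alone would have the least
    valuation [t * n]. *)
Lemma add_power_integrally_closed m :
  integral_closure (add_power m) `<=` add_power m.
Proof.
move=> z [n [c [n0 cF /eqP]]]; rewrite addr_eq0 => /eqP zn.
have [//|[t [v [lt_tm nMv Kz]]]] := unit_power_expansion m z; exfalso.
have Fz : add_power t z by exists v.
have [e Kzn] : add_power (t * n).+1 (z ^+ n).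
  rewrite zn; apply/(idealN (is_ideal_add_power _)).
  rewrite big_nat_cond; apply: ideal_sum => [|i]; first exact: is_ideal_add_power.
  rewrite andbT ltnS => /andP[i0 le_in].
  have Fc := add_power_exp (cF i _); rewrite i0 le_in in Fc.
  apply: add_power_leq (add_power_mul (Fc isT) (add_powerX (n - i) Fz)).
  by rewrite -{1}(subnKC le_in) mulnDr -addSn leq_add2r ltn_mul2r i0.
have Kv : K (z ^+ n - v ^+ n * a ^+ (t * n)).
  rewrite exprM -exprMn subrXX; exact: ideal_mulr.
have Kav : K (a ^+ (t * n) * (v ^+ n - e * a)).
  have -> : a ^+ (t * n) * (v ^+ n - e * a) =
    (z ^+ n - e * a ^+ (t * n).+1) - (z ^+ n - v ^+ n * a ^+ (t * n)).
    by rewrite exprS; ring.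
  exact: idealB.
have Kve : K (v ^+ n - e * a).
  elim: (t * n)%N Kav => [|k IHk]; first by rewrite expr0 mul1r.
  by rewrite exprS -mulrA => /a_reg.
apply/nMv/(@local_primeX _ n); rewrite -[v ^+ n](subrK (e * a)).
by apply: idealD => //; [apply: KM|apply: ideal_mull].
Qed.

End PrincipalModulo.

Section Link.
Variables (J : set S) (s : seq S).
Hypotheses (reg_s : regular_seq s) (Js : J = ideal_gen [set` s]).
Hypothesis JM : J `<=` M.
Hypothesis nilM : forall b, M b -> exists n, J (b ^+ n).

Let IJ : is_ideal J. Proof. by rewrite Js; apply: is_ideal_gen. Qed.

Definition span_except j : set S :=
  [set y | exists e : nat -> S, y = \sum_(i < size s | i != j :> nat) e i * s`_i].

Lemma is_ideal_span_except j : is_ideal (span_except j).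
Proof.
split=> [|_ _ [e ->] [f ->]|b _ [e ->]].
- by exists (fun=> 0); rewrite big1 // => i _; rewrite mul0r.
- exists (fun i => e i + f i); rewrite -big_split.
  by apply: eq_bigr => i _; rewrite mulrDl.
- exists (fun i => b * e i); rewrite mulr_sumr.
  by apply: eq_bigr => i _; rewrite mulrA.
Qed.

Lemma span_except_sub j : span_except j `<=` J.
Proof.
move=> _ [e ->]; rewrite Js; apply: ideal_sum => [|i _]; first exact: is_ideal_gen.
by apply: (ideal_mull _ (is_ideal_gen _)); apply: sub_ideal_gen => /=; rewrite mem_nth.
Qed.

Lemma regular_seq_relation (c : nat -> S) j :
  \sum_(i < size s) c i * s`_i = 0 -> (j < size s)%N -> span_except j (c j).
Proof.
move=> c0 ltj; apply: regular_relation c0 _ ltj => i lti y.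
have spanP u : ideal_gen [set` take i s] u <->
    exists e : nat -> S, u = \sum_(k < i) e k * s`_k.
  rewrite ideal_genP size_takel; last exact: ltnW.
  by split=> -[e ->]; exists e; apply: eq_bigr => k _; rewrite nth_take.
by move=> /spanP siy; apply/spanP; apply: reg_s.2 siy.
Qed.

Lemma regular_mod_rest j r : (j < size s)%N ->
  span_except j (s`_j * r) -> span_except j r.
Proof.
move=> ltj [e sr].
have := @regular_seq_relation (fun i => if i == j then r else - e i) j.
rewrite eqxx; apply=> //; rewrite (bigD1 (Ordinal ltj)) //= eqxx mulrC sr -big_split.
by rewrite big1 // => i; rewrite -?val_eqE /= => /negPf ->; rewrite mulNr subrr.
Qed.

(** If [M (J : M)] is not inside [M J], some product [a y] is a minimal generator
    of [J] and can replace [x_j]. Let [K] be generated by the other [x_i]. As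
    [a y] is regular modulo [K], from [y M <= J = K + (a y)] follows
    [M = K + (a)]. As a power of [a] is in [J] and [y] is not, [y] is a unit times
    [a ^+ t] modulo [K], so that [J = K + (a ^+ t.+1)]. *)
Lemma integrally_closed_of_minimal_product a y (b : nat -> S) j :
  M a -> colon J M y -> a * y = \sum_(i < size s) b i * s`_i ->
  (j < size s)%N -> ~ M (b j) -> integral_closure J `<=` J.
Proof.
move=> Ma Ly ayE ltj /unitM[u ub].
pose K := span_except j; have IK : is_ideal K := is_ideal_span_except j.
have KJ : K `<=` J := @span_except_sub j.
have KM : K `<=` M := subset_trans KJ JM.
have split_sum (e : nat -> S) : K (\sum_(i < size s) e i * s`_i - e j * s`_j).
  by exists e; rewrite (bigD1 (Ordinal ltj)) //= addrAC subrr add0r.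
have sjE : K (s`_j - u * (a * y)).
  have -> : s`_j - u * (a * y) =
    - u * (a * y - b j * s`_j) + (1 - u * b j) * s`_j by ring.
  rewrite ub subrr mul0r addr0 ayE; apply: ideal_mull => //.
have ay_reg r : K (a * y * r) -> K r.
  move=> Kr; apply: (regular_mod_rest ltj); rewrite -/K.
  have -> : s`_j * r = (s`_j - u * (a * y)) * r + u * (a * y * r) by ring.
  by apply: idealD => //; [apply: ideal_mulr|apply: ideal_mull].
have a_reg r : K (a * r) -> K r.
  by move=> Kr; apply: ay_reg; rewrite mulrAC; apply: ideal_mulr.
have y_reg r : K (r * y) -> K r.
  by move=> Kr; apply: ay_reg; rewrite -mulrA [y * r]mulrC; apply: ideal_mull.
have JE x : J x -> exists c, K (x - c * (a * y)).
  rewrite Js => /ideal_genP[e ->]; exists (e j * u).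
  set X := \sum_(i < _) _.
  have -> : X - e j * u * (a * y) =
    (X - e j * s`_j) + e j * (s`_j - u * (a * y)) by ring.
  by apply: idealD => //; [apply: split_sum|apply: ideal_mull].
have maxE x : M x -> exists c, K (x - c * a).
  move=> Mx; have [c Kc] := JE _ (Ly _ Mx); exists c; apply: y_reg.
  by have -> : (x - c * a) * y = y * x - c * (a * y) by ring.
have nJy : ~ J y.
  move=> /JE[c Kc]; apply: M1.
  have /KM M1c : K (1 - c * a).
    by apply: y_reg; have -> : (1 - c * a) * y = y - c * (a * y) by ring.
  by rewrite -[1](subrK (c * a)); apply: idealD => //; apply: ideal_mull.
have [N aN] := nilM Ma.
have [[c Kc]|[t [v [_ nMv Kv]]]] := unit_power_expansion IK maxE N y.
  exfalso; apply: nJy; rewrite -[y](subrK (c * a ^+ N)).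
  by apply: idealD => //; [apply: KJ|apply: ideal_mull].
have [v' v'v] := unitM nMv.
suff -> : J = add_power K a t.+1 by exact: add_power_integrally_closed.
apply/seteqP; split=> x.
  move=> /JE[c Kc]; exists (c * v).
  have -> : x - c * v * a ^+ t.+1 = (x - c * (a * y)) + (c * a) * (y - v * a ^+ t).
    by rewrite exprS; ring.
  by apply: idealD => //; apply: ideal_mull.
move=> [c Kc]; rewrite -[x](subrK (c * a ^+ t.+1)); apply: idealD => //; first exact: KJ.
apply: ideal_mull => //.
have -> : a ^+ t.+1 =
  v' * (y * a) - v' * a * (y - v * a ^+ t) + (1 - v' * v) * a ^+ t.+1.
  by rewrite exprS; ring.
rewrite v'v subrr mul0r addr0.
by apply: idealB => //; apply: ideal_mull => //; [apply: Ly|apply: KJ].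
Qed.

(** If [M (J : M)] is inside [M J], write [y1 y2 = sum_i c_i x_i]. For [a] in [M]
    also [a y1 = sum_i b_i x_i] with [b_i] in [M]; comparing the two expansions of
    [a y1 y2], the elements [a c_i - b_i y2] are the coefficients of a relation,
    hence lie in [J], and so does [b_i y2]. Thus every [c_i] is in [J : M]. *)
Lemma link_square z : integral_closure J z -> ~ J z ->
  forall y1 y2, colon J M y1 -> colon J M y2 -> ideal_mul J (colon J M) (y1 * y2).
Proof.
move=> zJ nJz y1 y2 Ly1 Ly2.
have coefM a y (b : nat -> S) : M a -> colon J M y ->
    a * y = \sum_(i < size s) b i * s`_i ->
    forall j, (j < size s)%N -> M (b j).
  move=> Ma Ly ayE j ltj; apply: contrapT => nMb; apply: nJz.
  exact: (integrally_closed_of_minimal_product Ma Ly ayE ltj nMb).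
have My1 : M y1.
  apply: contrapT => /unitM[u uy]; apply: nJz.
  have Mz : M z by apply: integral_closure_sub_max zJ.
  by rewrite -[z]mul1r -uy -mulrA; apply: ideal_mull => //; apply: Ly1.
have : J (y1 * y2) by rewrite mulrC; apply: Ly2.
rewrite {1}Js => /ideal_genP[c y12].
rewrite y12; apply: ideal_sum => [|i _]; first exact: is_ideal_mul.
rewrite mulrC; apply: mem_ideal_mul.
  by rewrite Js; apply: sub_ideal_gen => /=; rewrite mem_nth.
move=> a Ma; have : J (y1 * a) by apply: Ly1.
rewrite {1}Js => /ideal_genP[b ayE]; rewrite mulrC in ayE.
have Mb := coefM _ _ _ Ma Ly1 ayE i (ltn_ord i).
have Jc : J (a * c i - b i * y2).
  apply: (@span_except_sub i).
  apply: (@regular_seq_relation (fun k => a * c k - b k * y2)) => //.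
  rewrite (eq_bigr (fun k : 'I_(size s) => a * (c k * s`_k) - y2 * (b k * s`_k))); last first.
    by move=> k _; ring.
  by rewrite sumrB -!mulr_sumr -y12 -ayE; ring.
rewrite mulrC -[a * c i](subrK (b i * y2)); apply: idealD => //.
by rewrite mulrC; apply: Ly2.
Qed.

End Link.
End LocalRing.

(** * Localization at a prime *)

Section LocalizationAtPrime.
Variables (R : comNzRingType) (p : spec R).
Local Notation P := (spec_set p).
Implicit Types (I : set R).

Lemma is_ideal_prime : is_ideal p.
Proof. by case: (spec_prime p) => -[]. Qed.

Lemma prime_cancel u x : ~ P u -> P (u * x) -> P x.
Proof. by move=> npu /((spec_prime p).2)[]. Qed.

Lemma mult_set_compl_prime : mult_set [set u | ~ P u].
Proof.
split=> [|x y npx npy]; first exact: spec_not1.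
by move/(prime_cancel npx).
Qed.

Lemma mk_locM (x y : lfrac p) : mk_loc x * mk_loc y = mk_loc (frac_mul x y).
Proof. exact: loc_mulE. Qed.

Lemma mk_loc_to_loc x t : mk_loc (x, t) = mk_loc (1, t) * to_loc p x.
Proof. by rewrite /to_loc mk_locM; apply: mk_loc_eq => /=; ring. Qed.

Lemma is_ideal_loc I : is_ideal (loc_ideal p I).
Proof. exact: is_ideal_gen. Qed.

Lemma loc_idealP I x t : is_ideal I ->
  loc_ideal p I (mk_loc (x, t)) <-> exists2 u, ~ P u & I (u * x).
Proof.
move=> II; split=> [|[u npu Iux]]; last first.
  have npuE : u \notin spec_set p by rewrite notin_setE.
  pose d : denom p := exist _ u npuE.
  have -> : mk_loc (x, t) = mk_loc (1, den_mul d t) * to_loc P (u * x).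
    by rewrite /to_loc mk_locM; apply: mk_loc_eq => /=; ring.
  by apply: (ideal_mull _ (is_ideal_loc I)); apply: sub_ideal_gen; exists (u * x).
pose D : set (loc p) := [set a | exists y w, a = mk_loc (y, w) /\
  exists2 u, ~ P u & I (u * y)].
have ID : is_ideal D.
  split=> [|_ _ [y [w [-> [u npu Iu]]]] [y' [w' [-> [u' npu' Iu']]]]
             |a _ [y [w [-> [u npu Iu]]]]].
  - exists 0, (den1 p); split=> //; exists 1; first exact: spec_not1.
    by rewrite mulr0; apply: ideal0.
  - exists (y * val w' + y' * val w), (den_mul w w'); split; first exact: loc_addE.
    exists (u * u'); first exact: (mult_set_compl_prime.2).
    have -> : u * u' * (y * val w' + y' * val w) =
      (u' * val w') * (u * y) + (u * val w) * (u' * y') by ring.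
    by apply: idealD => //; apply: ideal_mull.
  - have [[b v] ->] := mk_loc_surj a; exists (b * y), (den_mul v w).
    split; first exact: mk_locM.
    by exists u => //; rewrite mulrCA; apply: ideal_mull.
suff sub : loc_ideal p I `<=` D.
  move=> /sub[y [w [/mk_locP[v /= /eqP vE] [u npu Iuy]]]].
  exists (u * (val v * val w)).
    by apply: (mult_set_compl_prime.2) => //; apply: (mult_set_compl_prime.2); apply: denP.
  move: vE; rewrite mulrBr subr_eq0 => /eqP vE.
  have -> : u * (val v * val w) * x = u * (val v * (x * val w)) by ring.
  rewrite vE; have -> : u * (val v * (y * val t)) = val v * val t * (u * y) by ring.
  exact: ideal_mull.
apply: ideal_gen_sub => // _ [y Iy <-]; exists y, (den1 p); split=> //.
by exists 1; [apply: spec_not1|rewrite mul1r].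
Qed.

Lemma loc_maxP x t : loc_ideal p p (mk_loc (x, t)) <-> P x.
Proof.
rewrite loc_idealP; last exact: is_ideal_prime.
split=> [[u npu]|px]; first exact: prime_cancel.
by exists 1; [apply: spec_not1|rewrite mul1r].
Qed.

Lemma loc_max_not1 : ~ loc_ideal p p 1.
Proof. by move/loc_maxP; apply: spec_not1. Qed.

Lemma loc_unit (a : loc p) : ~ loc_ideal p p a -> exists b, b * a = 1.
Proof.
have [[x t] ->] := mk_loc_surj a; rewrite loc_maxP => npx.
have npxE : x \notin spec_set p by rewrite notin_setE.
exists (mk_loc (val t, exist _ x npxE)); rewrite mk_locM.
by apply: mk_loc_eq => /=; ring.
Qed.

Lemma is_ideal_preim_loc (J : set (loc p)) :
  is_ideal J -> is_ideal [set x | J (to_loc p x)].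
Proof.
move=> IJ; split=> [|x y|a x]; rewrite /mkset ?rmorph0 ?rmorphD ?rmorphM.
- exact: ideal0.
- exact: idealD.
- exact: ideal_mull.
Qed.

Lemma to_loc_exp I n x :
  ideal_exp I n x -> ideal_exp (loc_ideal p I) n (to_loc p x).
Proof.
elim: n x => [//|n IHn] x.
suff: ideal_exp I n.+1 `<=` [set x | ideal_exp (loc_ideal p I) n.+1 (to_loc p x)] by apply.
apply: ideal_mul_sub => [|a b Ia Ib].
  exact/is_ideal_preim_loc/is_ideal_exp.
rewrite /mkset rmorphM; apply: mem_ideal_mul; last exact: IHn.
by apply: sub_ideal_gen; exists a.
Qed.

Lemma to_loc_integral I z :
  integral_closure I z -> integral_closure (loc_ideal p I) (to_loc p z).
Proof.
move=> [n [a [n0 aI zn]]]; exists n, (fun i => to_loc p (a i)); split=> //.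
  by move=> i /aI; apply: to_loc_exp.
rewrite -[RHS](rmorph0 (to_loc p)) -zn rmorphD rmorphXn rmorph_sum; congr (_ + _).
by apply: eq_bigr => i _; rewrite rmorphM rmorphXn.
Qed.

End LocalizationAtPrime.

(** * Height-unmixed ideals *)

Section Unmixed.
Variable R : comNzRingType.
Implicit Types (I P : set R).

Lemma associated_prime_sub I P : is_ideal I -> associated_prime I P -> I `<=` P.
Proof. by move=> II [_ [x ->]] y Iy _ ->; apply: ideal_mulr. Qed.

Lemma radical_sub_prime I P :
  prime_ideal P -> I `<=` P -> radical I `<=` P.
Proof.
move=> [[IP PT] PP] subP r [n /subP]; elim: n => [|n IHn]; last by rewrite exprS => /PP[].
rewrite expr0 => P1; exfalso; apply: PT; rewrite -subTset => x _.
by rewrite -[x]mulr1; apply: ideal_mull.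
Qed.

(** A chain of primes of length [h] ending at a prime over [I] strictly inside an
    associated prime [P] would make the height of [P] exceed [h]. *)
Lemma unmixed_associated_minimal I P : is_ideal I -> height_unmixed I ->
  associated_prime I P -> minimal_prime I P.
Proof.
move=> II [_ [h [[_ hI] hass]]] assP; have [_ nchain] := hass P assP.
split; [by case: assP|exact: associated_prime_sub|].
move=> Q primeQ IQ QP; apply: contrapT => neq; apply: nchain.
have [c [cQ cprime cmono]] := hI Q primeQ IQ.
exists (fun i => if (i <= h)%N then c i else P); split=> [|i|i].
- by rewrite ltnn.
- by case: (leqP i h) => [le _|_ _]; [apply: cprime|case: assP].
- rewrite ltnS => le_ih; rewrite le_ih; case: ltnP => [|ge]; first exact: cmono.
  have -> : i = h by apply/eqP; rewrite eqn_leq le_ih.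
  by rewrite cQ properEneq; split=> //; apply/eqP.
Qed.

Lemma mult_set1 : mult_set [set (1 : R)].
Proof. by split=> // x y -> ->; rewrite mulr1. Qed.

Lemma mult_set_powers (r : R) : mult_set [set t | exists n, t = r ^+ n].
Proof.
split=> [|_ _ [m ->] [n ->]]; first by exists 0%N; rewrite expr0.
by exists (m + n)%N; rewrite exprD.
Qed.

(** So [p] and the radical of [I] have the same localization at [p]. Otherwise the
    products [u * x ^+ n] with [u] outside [p] would all miss [I], and some prime
    over [I] inside [p] would miss [x], against the minimality of [p]. *)
Lemma radical_at_minimal_prime I (p : spec R) x : noetherian R -> is_ideal I ->
  minimal_prime I p -> spec_set p x ->
  exists2 u, ~ spec_set p u & radical I (u * x).
Proof.
move=> noeR II [_ _ minp] px; apply: contrapT => nrad.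
have [npM1 npM] := mult_set_compl_prime p.
pose T : set R := [set t | exists u n, ~ spec_set p u /\ t = u * x ^+ n].
have multT : mult_set T.
  split=> [|_ _ [u [n [npu ->]]] [v [m [npv ->]]]].
    by exists 1, 0%N; rewrite expr0 mulr1.
  exists (u * v), (n + m)%N; split; first exact: npM.
  by rewrite exprD mulrACA.
have [|c [assQ QT]] := associated_prime_avoiding (z := 1) noeR II multT.
  move=> _ [u [n [npu ->]]]; rewrite mulr1 => Iux; apply: nrad; exists u => //.
  exists n.+1; rewrite exprMn exprS [x ^+ _]exprSr.
  have -> : u * u ^+ n * (x ^+ n * x) = u ^+ n * x * (u * x ^+ n) by ring.
  exact: ideal_mull.
have Qp : colon I [set c * 1] `<=` p.
  move=> q Qq; apply: contrapT => npq; apply: (QT q) => //.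
  by exists q, 0%N; rewrite expr0 mulr1.
have QE := minp _ assQ.1 (associated_prime_sub II assQ) Qp.
apply: (QT x); last by rewrite QE.
by exists 1, 1%N; rewrite expr1 mul1r.
Qed.

End Unmixed.

(** * The link of an ideal with its radical *)

Section RadicalLink.
Variables (R : comNzRingType) (I : set R).
Hypotheses (noeR : noetherian R) (II : is_ideal I).
Let L := colon I (radical I).

Let IL : is_ideal L. Proof. exact: is_ideal_colon. Qed.

Lemma ideal_square_sub (J : set R) : is_ideal J ->
  (forall x y, L x -> L y -> J (x * y)) -> ideal_exp L 2 `<=` J.
Proof.
move=> IJ LJ; apply: ideal_mul_sub => // x y Lx L1y; apply: LJ => //.
exact: (ideal_expS_sub (n := 0) IL L1y).
Qed.

Lemma radical_sub_colon : radical I `<=` colon (ideal_mul I L) (ideal_exp L 2).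
Proof.
move=> r radr b; suff: ideal_exp L 2 `<=` [set b | ideal_mul I L (r * b)] by apply.
have IM := is_ideal_mul I L.
apply: ideal_square_sub => [|x y Lx Ly].
  split=> [|x y Mx My|a x Mx]; rewrite /mkset.
  - by rewrite mulr0; apply: (ideal0 IM).
  - by rewrite mulrDr; apply: (idealD IM).
  - by rewrite mulrCA; apply: (ideal_mull _ IM).
by rewrite /mkset mulrA; apply: mem_ideal_mul => //; rewrite mulrC; apply: Lx.
Qed.

(** If [r L^2 <= I L], then [r L] is integral over [I], so that [r L <= I] once [I]
    is integrally closed. An associated prime [I : x] of [I] always has [x] in
    [L], because it contains the radical; hence [r] is in every associated prime,
    whereas an element outside the radical is missed by one of them. *)
Lemma colon_sub_radical : integrally_closed I ->
  colon (ideal_mul I L) (ideal_exp L 2) `<=` radical I.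
Proof.
move=> intI r rL2.
have rLI x : L x -> I (r * x).
  move=> Lx; rewrite intI; apply: (integral_of_mul_sub noeR II IL).
    exact: (ideal_mull _ IL).
  move=> y Ly; rewrite -mulrA; apply: rL2.
  by apply: (ideal_expD (m := 1) (n := 1)); apply: mem_ideal_exp1.
apply: contrapT => nradr.
have [|c [assP Pr]] := associated_prime_avoiding (z := 1) noeR II (mult_set_powers r).
  by move=> _ [n ->]; rewrite mulr1 => Irn; apply: nradr; exists n.
apply: (Pr r); first by exists 1%N; rewrite expr1.
move=> _ ->; apply: rLI => y rady.
have := radical_sub_prime assP.1 (associated_prime_sub II assP) rady.
by move=> /(_ _ erefl); rewrite mulrC.
Qed.

Section AtMinimalPrime.
Variable p : spec R.
Local Notation P := (spec_set p).
Hypothesis minp : minimal_prime I p.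
Let S := loc p.
Let J : set S := loc_ideal p I.
Let M : set S := loc_ideal p p.

Let Ip : I `<=` p. Proof. by case: minp. Qed.

Lemma loc_max_nilpotent (b : S) : M b -> exists n, J (b ^+ n).
Proof.
have [[x t] ->] := mk_loc_surj b => /loc_maxP px.
have [u npu [n Iuxn]] := radical_at_minimal_prime noeR II minp px.
exists n; rewrite mk_loc_to_loc exprMn -rmorphXn.
apply: (ideal_mull _ (is_ideal_loc p I)); apply/(loc_idealP _ _ II).
exists (u ^+ n); last by rewrite -exprMn.
elim: n {Iuxn} => [|n IHn]; first by rewrite expr0; apply: spec_not1.
by rewrite exprS => /(prime_cancel npu).
Qed.

Lemma to_loc_link l : L l -> colon J M (to_loc p l).
Proof.
move=> Ll a; have [[x t] ->] := mk_loc_surj a => /loc_maxP px.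
rewrite mk_locM; apply/(loc_idealP _ _ II).
have [u npu radux] := radical_at_minimal_prime noeR II minp px.
by exists u => //=; rewrite mulrCA; apply: Ll.
Qed.

Lemma loc_link_mul_sub : ideal_mul J (colon J M) `<=` loc_ideal p (ideal_mul I L).
Proof.
apply: ideal_mul_sub => [|a b]; first exact: is_ideal_loc.
have [[x t] ->] := mk_loc_surj a => /(loc_idealP _ _ II)[u npu Iux].
have [[l w] ->] := mk_loc_surj b => Ll.
have [v npv vl] : exists2 v, ~ P v & forall y, P y -> [set y | I (l * y)] (v * y).
  apply: (common_multiplier noeR (mult_set_compl_prime p) (is_ideal_prime p)).
    split=> [|y y' Iy Iy'|c y Iy]; rewrite /mkset.
    - by rewrite mulr0; apply: ideal0.
    - by rewrite mulrDr; apply: idealD.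
    - by rewrite mulrCA; apply: ideal_mull.
  move=> y py; have /(loc_maxP y (den1 p)) /Ll : P y by [].
  rewrite mk_locM => /(loc_idealP _ _ II)[v npv Iv].
  by exists v => //; rewrite /mkset mulrCA.
rewrite mk_locM; apply/(loc_idealP _ _ (is_ideal_mul I L)).
exists (u * v); first exact: (mult_set_compl_prime p).2.
rewrite /= mulrACA; apply: mem_ideal_mul => // y rady.
have := vl y (radical_sub_prime (spec_prime p) Ip rady).
by rewrite /mkset -mulrA mulrCA.
Qed.

(** Descent of [L_p^2 <= I_p L_p]: finitely many denominators are cleared at once. *)
Lemma link_square_at_minimal_prime z :
  complete_intersection J -> integral_closure I z -> ~ J (to_loc p z) ->
  exists2 r, ~ P r & colon (ideal_mul I L) (ideal_exp L 2) r.
Proof.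
move=> [s [reg_s Js]] zI nJz.
apply: (common_multiplier noeR (mult_set_compl_prime p)).
- exact: is_ideal_exp.
- exact: is_ideal_mul.
move=> x L2x; apply/(loc_idealP x (den1 p) (is_ideal_mul I L)).
suff: ideal_exp L 2 `<=` [set x | loc_ideal p (ideal_mul I L) (to_loc p x)] by apply.
apply: ideal_square_sub => [|l1 l2 Ll1 Ll2].
  exact/is_ideal_preim_loc/is_ideal_loc.
rewrite /mkset rmorphM; apply: loc_link_mul_sub.
apply: (link_square (is_ideal_loc p p) (@loc_max_not1 _ p) (@loc_unit _ p) reg_s Js
  _ loc_max_nilpotent (to_loc_integral p zI) nJz); try exact: to_loc_link.
apply: ideal_gen_sub => [|_ [y Iy <-]]; first exact: is_ideal_loc.
by apply: sub_ideal_gen; exists y => //; apply: Ip.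
Qed.

End AtMinimalPrime.
End RadicalLink.

Theorem theorem2p1 (R : comNzRingType) (I : set R)
    (hR : cohen_macaulay R)
    (hI : is_ideal I)
    (hunm : height_unmixed I)
    (hci : generically_complete_intersection I) :
  let L := colon I (radical I) in
  integrally_closed I <->
  radical I = colon (ideal_mul I L) (ideal_exp L 2).
Proof.
move=> L; have noeR := hR.1; split=> [intI|radE].
  apply/seteqP; split; [exact: radical_sub_colon|exact: colon_sub_radical].
apply/seteqP; split=> [x Ix|z zI].
  exists 1%N, (fun=> - x); split=> // [i|].
    by case: i => [|[|i]] // _; apply: (idealN (is_ideal_exp I 1)); apply: mem_ideal_exp1.
  by rewrite big_nat1 expr0 mulr1 expr1 subrr.
apply: contrapT => nIz.
have [|c [assP _]] := associated_prime_avoiding (z := z) noeR hI (mult_set1 R).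
  by move=> _ ->; rewrite mul1r.
have minP := unmixed_associated_minimal hI hunm assP.
pose p := Spec assP.1.
have [||r npr rL] := @link_square_at_minimal_prime R I noeR hI p minP z _ zI.
- exact: hci.
- move=> /(loc_idealP _ _ hI)[u npu Iuz]; apply: npu => _ ->.
  by rewrite mulrCA; apply: ideal_mull.
apply: npr; apply: (radical_sub_prime assP.1 (associated_prime_sub hI assP)).
by rewrite radE.
Qed.
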